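(* For any $\gamma \in (0, 1/4)$ and any $p \in [1, \infty)$, there exist (a domain $\mathcal{X}$, a parameter set $\mathcal{R}$, and) function classes $\mathcal{F} = \{f_r \mid r \in \mathcal{R}\}$, $\mathcal{G} = \{g_r \mid r \in \mathcal{R}\} \subset [0,1]^{\mathcal{X}}$ such that the dual class $\mathcal{G}^*$ $(\gamma, p)$-approximates the dual class $\mathcal{F}^*$ and for any $N \geq 1$, $$\sup_{\mathcal{S} \subseteq \mathcal{X} : |\mathcal{S}| = N} \widehat{\mathfrak{R}}_{\mathcal{S}}(\mathcal{G}) = 0 \quad\text{and}\quad \sup_{\mathcal{S} \subseteq \mathcal{X}: |\mathcal{S}| = N} \widehat{\mathfrak{R}}_{\mathcal{S}}(\mathcal{F}) = \frac{1}{2}.$$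
   Context: $[0,1]^{\mathcal{X}}$ is the set of all functions $\mathcal{X} \to [0,1]$. Function classes are parameterized by a set $\mathcal{R} \subseteq \mathbb{R}^d$. For $x \in \mathcal{X}$ the dual functions $f_x^*, g_x^* : \mathcal{R} \to [0,1]$ are $f_x^*(r) = f_r(x)$, $g_x^*(r) = g_r(x)$; the dual classes are $\mathcal{F}^* = \{f_x^* \mid x \in \mathcal{X}\}$ and $\mathcal{G}^* = \{g_x^* \mid x \in \mathcal{X}\}$. All dual functions are assumed integrable over $\mathcal{R}$. For $p \in [1,\infty)$, $\mathcal{G}^*$ $(\gamma,p)$-approximates $\mathcal{F}^*$ if for every $x \in \mathcal{X}$, $\|f_x^* - g_x^*\|_p := \left(\int_{\mathcal{R}} |f_x^*(r) - g_x^*(r)|^p \, dr\right)^{1/p} \leq \gamma$ (Lebesgue measure). The empirical Rademacher complexity of $\mathcal{F}$ given $\mathcal{S} = \{x_1, \dots, x_N\} \subseteq \mathcal{X}$ is $$\widehat{\mathfrak{R}}_{\mathcal{S}}(\mathcal{F}) = \frac{1}{N}\, \mathbb{E}_{\sigma \sim \{-1,1\}^N}\left[\sup_{r \in \mathcal{R}} \sum_{i=1}^N \sigma_i f_r(x_i)\right],$$ where the $\sigma_i$ are independent and uniform on $\{-1,1\}$; likewise for $\mathcal{G}$. *)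

(* Defs.v *)
From HB Require Import structures.
From mathcomp Require Import all_boot all_order all_algebra.
From mathcomp Require Import all_classical all_reals all_analysis.
Set Implicit Arguments.
Unset Strict Implicit.
Unset Printing Implicit Defensive.
Import Order.TTheory GRing.Theory Num.Theory.
Import numFieldNormedType.Exports.
Local Open Scope classical_set_scope.
Local Open Scope ring_scope.

(* R^d is carried by d-tuples, which the library equips with the product
   (hence Borel) sigma-algebra. *)
Notation euclidean R d := (d.-tuple (measurableTypeR R)).

Section lebesgue_tuple_step.
Context (R : realType) (n : nat).
Variable m : {sigma_finite_measure set (euclidean R n) -> \bar R}.

Definition tuple_consf (z : measurableTypeR R * euclidean R n) :
  euclidean R n.+1 := [tuple of z.1 :: z.2].

Lemma measurable_tuple_consf : measurable_fun [set: _] tuple_consf.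
Proof.
by apply: (@measurable_cons _ _ _ _ fst _ snd);
  [exact: measurable_fst|exact: measurable_snd].
Qed.

Lemma preimage_tuple_consf (A : 'I_n.+1 -> set R) :
  tuple_consf @^-1` [set t : euclidean R n.+1 | forall i, A i (tnth t i)] =
  A ord0 `*`
  [set t : euclidean R n | forall i, A (lift ord0 i) (tnth t i)].
Proof.
apply/seteqP; split=> [[x t] /= h|[x t] /= [h0 h] i].
  by split=> [|i]; [have := h ord0; rewrite tnth0
                  |have := h (lift ord0 i); rewrite tnthS].
by case: (unliftP ord0 i) => [j|] ->; rewrite ?tnthS ?tnth0.
Qed.

Definition lebesgue_cons : set (euclidean R n.+1) -> \bar R :=
  pushforward (@lebesgue_measure R \x m)%E tuple_consf.

Let lebesgue_cons0 : lebesgue_cons set0 = 0%E.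
Proof. by rewrite /lebesgue_cons /pushforward preimage_set0 measure0. Qed.

Let lebesgue_cons_ge0 A : (0 <= lebesgue_cons A)%E.
Proof. by rewrite /lebesgue_cons /pushforward; exact: measure_ge0. Qed.

Let lebesgue_cons_sigma_additive : semi_sigma_additive lebesgue_cons.
Proof.
move=> F mF tF mUF; rewrite /lebesgue_cons /pushforward preimage_bigcup.
apply: measure_semi_sigma_additive.
- by move=> k; rewrite -[X in measurable X]setTI; exact: measurable_tuple_consf.
- apply/trivIsetP => /= i j _ _ ij; rewrite -preimage_setI.
  by move/trivIsetP : tF => /(_ _ _ _ _ ij) ->//; rewrite preimage_set0.
- rewrite -preimage_bigcup -[X in measurable X]setTI.
  exact: measurable_tuple_consf.
Qed.

HB.instance Definition _ := isMeasure.Build _ _ _ lebesgue_cons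
  lebesgue_cons0 lebesgue_cons_ge0 lebesgue_cons_sigma_additive.

Let lebesgue_cons_sigma_finite : sigma_finite setT lebesgue_cons.
Proof.
have [F TF Foo] : sigma_finite setT (@lebesgue_measure R \x m)%E.
  have /sigma_finiteP[F [TF ndF Foo]] := sigma_finiteT (@lebesgue_measure R).
  have /sigma_finiteP[G [TG ndG Goo]] := sigma_finiteT m.
  exists (fun k => F k `*` G k).
    rewrite -setXTT TF TG; apply/seteqP; split=> -[x t] /=.
      move=> [[i _ Fx] [j _ Gt]]; exists (maxn i j) => //; split => /=.
        by move: x Fx; exact/subsetPset/ndF/leq_maxl.
      by move: t Gt; exact/subsetPset/ndG/leq_maxr.
    by move=> [k _ []/= ? ?]; split; exists k.
  move=> k; have [? ?] := Foo k; have [? ?] := Goo k.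
  split; first exact: measurableX.
  by rewrite product_measure1E// lte_mul_pinfty// ge0_fin_numE.
pose u (t : euclidean R n.+1) : measurableTypeR R * euclidean R n :=
  (thead t, [tuple of behead t]).
have mu : measurable_fun [set: _] u.
  apply/measurable_fun_pairP; split; first exact: measurable_tnth.
  exact: measurable_behead.
exists (fun k => u @^-1` F k).
  by rewrite -preimage_bigcup -TF preimage_setT.
move=> k; split.
  by rewrite -[X in measurable X]setTI; apply: mu => //; case: (Foo k).
rewrite /lebesgue_cons /pushforward.
rewrite (_ : _ @^-1` _ = F k); first by case: (Foo k).
rewrite -comp_preimage (_ : u \o tuple_consf = id)//.
apply/funext => -[x t]; congr pair => //=.
by apply/val_inj.
Qed.

HB.instance Definition _ := Measure_isSigmaFinite.Build _ _ _ lebesgue_cons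
  lebesgue_cons_sigma_finite.

End lebesgue_tuple_step.

(* Lebesgue measure on R^d, as the d-fold product of the one-dimensional one;
   [lebesgue_tuple_box] below is the usual volume formula. *)
Fixpoint lebesgue_tuple (R : realType) (d : nat) :
    {sigma_finite_measure set (euclidean R d) -> \bar R} :=
  if d is n.+1 then lebesgue_cons (lebesgue_tuple R n)
  else \d_([tuple] : euclidean R 0).

Lemma measurable_tuple_box (R : realType) (d : nat)
    (A : 'I_d -> set (measurableTypeR R)) : (forall i, measurable (A i)) ->
  measurable [set t : euclidean R d | forall i, A i (tnth t i)].
Proof.
move=> mA.
have -> : [set t : euclidean R d | forall i, A i (tnth t i)] =
    \bigcap_(i in [set: 'I_d]) ((fun t => tnth t i) @^-1` A i).
  by apply/seteqP; split=> t /= h i => [_|]; exact: h.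
apply: fin_bigcap_measurable => // i _; rewrite -[X in measurable X]setTI.
exact: measurable_tnth.
Qed.

Lemma lebesgue_tuple_box (R : realType) (d : nat)
    (A : 'I_d -> set (measurableTypeR R)) : (forall i, measurable (A i)) ->
  lebesgue_tuple R d [set t : euclidean R d | forall i, A i (tnth t i)] =
  (\prod_(i < d) lebesgue_measure (A i))%E.
Proof.
elim: d A => [|d ih] A mA.
  by rewrite big_ord0 /= diracE mem_set//= => -[].
rewrite big_ord_recl -ih//= /lebesgue_cons /pushforward preimage_tuple_consf.
rewrite product_measure1E //.
by apply: (@measurable_tuple_box R d (fun i => A (lift ord0 i))) => i; exact: mA.
Qed.

Section classes.
Context (R : realType) (d : nat) (X : Type).

(* A class {f_r | r in P} is given by the family f and the parameter set P;
   the dual function of f at x is (f ^~ x); values off P play no role. *)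
Variable P : set (euclidean R d).

Definition unit_valued (f : euclidean R d -> X -> R) : Prop :=
  forall r x, P r -> 0 <= f r x <= 1.

Definition dual_integrable (f : euclidean R d -> X -> R) : Prop :=
  forall x, (lebesgue_tuple R d).-integrable P (fun r => (f r x)%:E).

Definition dual_Lp_dist (p : R) (f g : euclidean R d -> X -> R) (x : X) :
    \bar R :=
  ((\int[lebesgue_tuple R d]_(r in P) (`|f r x - g r x| `^ p)%:E) `^ p^-1)%E.

Definition dual_approximates (gamma p : R) (g f : euclidean R d -> X -> R) :
    Prop :=
  forall x, (dual_Lp_dist p f g x <= gamma%:E)%E.

(* The expectation over independent uniform signs is the average over the 2^N
   sign vectors; [false] stands for +1 and [true] for -1. *)
Definition rademacher (f : euclidean R d -> X -> R) (N : nat)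
    (x : 'I_N -> X) : R :=
  N%:R^-1 *
  ((2 ^+ N)^-1 * \sum_(s : {ffun 'I_N -> bool})
     sup [set \sum_(i < N) (-1) ^+ s i * f r (x i) | r in P]).

(* A sample S = {x_1, ..., x_N} with |S| = N is an injective enumeration;
   the complexity does not depend on the enumeration chosen. *)
Definition sup_rademacher (f : euclidean R d -> X -> R) (N : nat) : R :=
  sup [set rademacher f x | x in [set x : 'I_N -> X | injective x]].

End classes.

(* Main.v *)
Require Import Defs.
From HB Require Import structures.
From mathcomp Require Import all_boot all_order all_algebra.
From mathcomp Require Import all_classical all_reals all_analysis.
From mathcomp Require Import measurable_realfun.
Set Implicit Arguments.
Unset Strict Implicit.
Unset Printing Implicit Defensive.
Import Order.TTheory GRing.Theory Num.Theory.
Import numFieldNormedType.Exports.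
Local Open Scope classical_set_scope.
Local Open Scope ring_scope.

(** A class with values in {0,1} that realises every dichotomy of a sample has
    empirical Rademacher complexity exactly 1/2 on it: the supremum for a sign
    vector is its number of positive signs, which is N/2 on average.  Take
    X = nat and attach to every finite set a of naturals a point of R^d; let
    f_r be the indicator of a at the point attached to a, and 0 at all other
    parameters.  Every finite sample is then shattered, while each dual function
    is supported on a countable set, so that it is at L^p distance 0 from the
    zero function, whose class has complexity 0. *)

(** An injection into the naturals cuts [A] into countably many fibres, each empty or inside a null
    singleton, hence negligible. *)
Lemma countable_measure0 d (T : sigmaRingType d) (R : realFieldType)
    (mu : {measure set T -> \bar R}) (A : set T) :
  (forall t : T, measurable [set t]) -> (forall t : T, mu [set t] = 0%E) ->
  countable A -> mu A = 0%E.
Proof.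
move=> m1 mu1 cA; have mA : measurable A by exact: countable_measurable.
apply/(negligibleP mu mA); have /countable_injP[f injf] := cA.
have -> : A = \bigcup_k (A `&` f @^-1` [set k]).
  by apply/seteqP; split=> [t At|t [k _ []//]]; exists (f t).
apply: negligible_bigcup => k.
have [->|/set0P[t [At ft]]] := eqVneq (A `&` f @^-1` [set k]) set0.
  exact: negligible_set0.
apply: (@negligibleS _ _ _ mu [set t]); last first.
  exists [set t]; split; [exact: m1|exact: mu1|by []].
by move=> u [Au fu]; apply: injf; rewrite ?inE//= fu.
Qed.

Section points.
Context (R : realType) (d : nat).
Implicit Types (t : euclidean R d) (A : set (euclidean R d)).

(** Seen as a degenerate box, a point falls under the measurability and volume results for boxes. *)
Let set1_tuple t :
  [set t] = [set u : euclidean R d | forall i, [set tnth t i] (tnth u i)].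
Proof. by apply/seteqP; split=> [u -> //|u h]; exact: eq_from_tnth. Qed.

Lemma measurable_tuple_set1 t : measurable [set t].
Proof.
rewrite set1_tuple; apply: (measurable_tuple_box (A := fun i => [set tnth t i])).
by move=> i; exact: measurable_set1.
Qed.

Lemma lebesgue_tuple_set1 t : (0 < d)%N -> lebesgue_tuple R d [set t] = 0%E.
Proof.
move=> hd; rewrite set1_tuple (lebesgue_tuple_box (A := fun i => [set tnth t i]));
  last first.
  by move=> i; exact: measurable_set1.
(* Since [0 < d], the product of side lengths has at least one factor, and that factor is 0. *)
by rewrite (bigD1 (Ordinal hd))//= lebesgue_measure_set1 mul0e.
Qed.

Lemma lebesgue_tuple_countable A :
  (0 < d)%N -> countable A -> lebesgue_tuple R d A = 0%E.
Proof.
move=> hd; apply: countable_measure0 => t; first exact: measurable_tuple_set1.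
exact: lebesgue_tuple_set1.
Qed.

End points.

(** Flipping all signs permutes the sign vectors, so positive and negative signs have the same
    total; the two counts add up to [N] for each vector. *)
Lemma average_signs (R : realFieldType) (N : nat) :
  (2 ^+ N)^-1 * \sum_(s : {ffun 'I_N -> bool}) \sum_(i < N) (~~ s i)%:R
  = N%:R / 2 :> R.
Proof.
set S := \sum_(s : {ffun 'I_N -> bool}) _.
have SE : S = \sum_(s : {ffun 'I_N -> bool}) \sum_(i < N) (s i)%:R.
  have inv : involutive (fun s : {ffun 'I_N -> bool} => [ffun i => ~~ s i]).
    by move=> s; apply/ffunP => i; rewrite !ffunE negbK.
  rewrite /S (reindex_inj (inv_inj inv)); apply: eq_bigr => s _.
  by apply: eq_bigr => i _; rewrite ffunE negbK.
have h : S * 2 = 2 ^+ N * N%:R.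
  rewrite mulr_natr mulr2n {2}SE -big_split/= (eq_bigr (fun=> N%:R)) => [|s _].
    by rewrite sumr_const card_ffun card_bool card_ord -[LHS]mulr_natl natrX.
  rewrite -big_split/= (eq_bigr (fun=> 1)) ?sumr_const ?card_ord// => i _.
  by case: (s i); rewrite ?addr0 ?add0r.
have -> : S = 2 ^+ N * (N%:R / 2) by rewrite mulrA -h mulfK.
by rewrite mulKf// expf_neq0.
Qed.

Section classes.
Context (R : realType) (d : nat) (X : Type) (P : set (euclidean R d)).
Implicit Types f : euclidean R d -> X -> R.

(** As [false] encodes the sign +1, [~~ s i] bounds the i-th term of the correlation for
    {0,1}-values. Shattering attains all these bounds at a single parameter, so each supremum is a
    maximum. *)
Lemma rademacher_shattered f (b : euclidean R d -> X -> bool) (N : nat)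
    (x : 'I_N -> X) : (0 < N)%N ->
  (forall r y, f r y = (b r y)%:R) ->
  (forall s : {ffun 'I_N -> bool},
     exists2 r, P r & forall i, b r (x i) = ~~ s i) ->
  rademacher P f x = 1 / 2.
Proof.
move=> N0 fE sh; rewrite /rademacher.
rewrite (eq_bigr (fun s : {ffun 'I_N -> bool} => \sum_(i < N) (~~ s i)%:R)).
  by rewrite average_signs mulrA mulVf// pnatr_eq0 -lt0n.
move=> s _; set E := (X in sup X).
have ubE : ubound E (\sum_(i < N) (~~ s i)%:R).
  move=> _ [r Pr <-]; apply: ler_sum => i _; rewrite fE.
  by case: (s i); case: (b r _) => /=;
    rewrite ?expr0 ?expr1 ?mulr1 ?mulr0// lerN10.
have inE : E (\sum_(i < N) (~~ s i)%:R).
  have [r Pr rE] := sh s; exists r => //; apply: eq_bigr => i _.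
  by rewrite fE rE; case: (s i); rewrite /= ?expr0 ?mulr1 ?mulr0.
apply/eqP; rewrite eq_le; apply/andP; split.
  by apply: ge_sup => //; exists (\sum_(i < N) (~~ s i)%:R).
by apply: ub_le_sup => //; exists (\sum_(i < N) (~~ s i)%:R).
Qed.

Lemma rademacher0 (N : nat) (x : 'I_N -> X) :
  P !=set0 -> rademacher P (fun _ _ => 0) x = 0.
Proof.
move=> [r Pr]; rewrite /rademacher big1 ?mulr0// => s _.
rewrite (_ : [set _ | _ in _] = [set 0]) ?sup1//.
have E0 : \sum_(i < N) (-1) ^+ s i * 0 = 0 :> R.
  by rewrite big1// => i; rewrite mulr0.
by apply/seteqP; split=> [_ [? _ <-]//|_ ->]; exists r.
Qed.

Lemma sup_rademacher_cst f (N : nat) (c : R) :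
  (exists x : 'I_N -> X, injective x) ->
  (forall x : 'I_N -> X, injective x -> rademacher P f x = c) ->
  sup_rademacher P f N = c.
Proof.
move=> [x xinj] fc.
(* The given injective sample makes this set nonempty; the supremum of the empty set would default
   to 0. *)
rewrite /sup_rademacher (_ : [set _ | _ in _] = [set c]) ?sup1//.
by apply/seteqP; split=> [_ [y yi <-]|_ ->]; [exact: fc|exists x => //; exact: fc].
Qed.

End classes.

Section codes.
Context (R : realType) (d : nat).

(** Finite sets are represented by lists, numbered by [pickle] and placed on the diagonal of the
    parameter space. *)
Definition code (a : seq nat) : euclidean R d := [tuple (pickle a)%:R | _ < d].

Lemma code_inj : (0 < d)%N -> injective code.
Proof.
move=> hd a b /(congr1 (fun t => tnth t (Ordinal hd))).
by rewrite !tnth_mktuple => /eqP; rewrite eqr_nat => /eqP/(pcan_inj pickleK).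
Qed.

(** This is the support of the dual function at [x]. *)
Definition codes_of (x : nat) : set (euclidean R d) :=
  code @` [set a | x \in a].

Lemma mem_codes_of a x : (0 < d)%N -> (code a \in codes_of x) = (x \in a).
Proof.
move=> hd; apply/idP/idP => [|xa]; last by rewrite inE; exists a.
by rewrite inE => -[b xb] /(code_inj hd) <-.
Qed.

Lemma countable_codes_of x : countable (codes_of x).
Proof. exact: sub_countable (card_image_le _ _) (countableP _). Qed.

Lemma measurable_codes_of x : measurable (codes_of x).
Proof.
apply: countable_measurable (countable_codes_of x).
exact: measurable_tuple_set1.
Qed.

Lemma integral_codes_of x : (0 < d)%N ->
  (\int[lebesgue_tuple R d]_r (\1_(codes_of x) r)%:E = 0)%E.
Proof.
move=> hd; rewrite integral_indic//; last exact: measurable_codes_of.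
rewrite setIT; apply: lebesgue_tuple_countable => //.
exact: countable_codes_of.
Qed.

End codes.

Theorem theorem4p9 (R : realType) (d : nat) (hd : (0 < d)%N)
    (gamma p : R) (hgamma : 0 < gamma < 1 / 4) (hp : 1 <= p) :
  exists (X : Type) (P : set (euclidean R d)) (f g : euclidean R d -> X -> R),
    [/\ measurable P,
        unit_valued P f /\ unit_valued P g,
        dual_integrable P f /\ dual_integrable P g,
        dual_approximates P gamma p g f
      & forall N : nat, (1 <= N)%N ->
          sup_rademacher P g N = 0 /\ sup_rademacher P f N = 1 / 2].
Proof.
pose f (r : euclidean R d) (x : nat) : R := \1_(codes_of x) r.
exists nat, setT, f, (fun _ _ => 0).
have p0 : 0 < p by exact: lt_le_trans hp.
split.
- exact: measurableT.
- split=> r x _; last by rewrite lexx ler01.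
  by rewrite /f indicE ler0n lern1 leq_b1.
- split=> x; last exact: integrable0.
  apply/integrableP; split.
    apply/measurable_EFinP/measurable_indic.
    exact: measurable_codes_of.
  under eq_integral do rewrite gee0_abs ?lee_fin ?ler0n//.
  by rewrite integral_codes_of.
- move=> x; rewrite /dual_Lp_dist.
  (* An indicator equals its own [p]-th power, 0 being sent to 0 because [p] is nonzero. *)
  under eq_integral => r _.
    rewrite subr0 (_ : `|_| `^ p = \1_(codes_of x) r); last first.
      rewrite /f indicE; case: (_ \in _).
        by rewrite normr1 powR1.
      by rewrite normr0 powR0// gt_eqF.
    over.
  rewrite integral_codes_of// poweR0r ?lee_fin ?invr_neq0 ?gt_eqF//.
  by case/andP: hgamma => /ltW.
- move=> N N0.
  have ex : exists x : 'I_N -> nat, injective x.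
    by exists (@nat_of_ord N); exact: val_inj.
  split; apply: sup_rademacher_cst => // x xinj.
    by apply: rademacher0; exists [tuple (0 : R) | _ < d].
  apply: (@rademacher_shattered _ _ _ _ _
    (fun r y => r \in codes_of y)) => // [s].
  (* The witness encodes the sample points of sign +1; by injectivity of [x], no point of sign -1
     coincides with one of them. *)
  exists (code R d [seq x i | i <- enum 'I_N & ~~ s i]) => // i.
  by rewrite mem_codes_of// mem_map// mem_filter mem_enum andbT.
Qed.
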